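(* Let $(W,S)$ be a Coxeter system with length function $\ell$, let $\mathfrak{H}$ be its Hecke algebra with respect to a weight function $L\colon W\to\mathbb{Z}$, and let $x,y\in W$. Write $T_xT_y=\sum_{w\in W} r_w^{x,y}\,T_w$ with $r_w^{x,y}\in\mathbb{Z}[v,v^{-1}]$. Then $r_w^{x,y}=0$ unless $\ell(xy)\le \ell(w)\le \ell(x)+\ell(y)$.
   Context: A weight function on $(W,S)$ is a map $L\colon W\to\mathbb{Z}$ with $L(ww')=L(w)+L(w')$ whenever $\ell(ww')=\ell(w)+\ell(w')$. For $s\in S$ put $v_s:=v^{L(s)}\in\mathbb{Z}[v,v^{-1}]$, where $v$ is an indeterminate. The Hecke algebra $\mathfrak{H}=\mathfrak{H}(W)$ is the associative unital $\mathbb{Z}[v,v^{-1}]$-algebra generated by elements $T_s$ ($s\in S$) with the relations: (i) $(T_s-v_s)(T_s+v_s^{-1})=0$ for all $s\in S$; (ii) $T_{s_1}T_{s_2}T_{s_1}\cdots=T_{s_2}T_{s_1}T_{s_2}\cdots$ for all $s_1\neq s_2$ in $S$ such that $s_1s_2$ has finite order, with the number of factors on each side equal to the order of $s_1s_2$. For $x\in W$ with reduced expression $x=s_1s_2\cdots s_n$ set $T_x:=T_{s_1}T_{s_2}\cdots T_{s_n}$ (independent of the choice of reduced expression). The set $\{T_x : x\in W\}$ is a basis of $\mathfrak{H}$ as a free $\mathbb{Z}[v,v^{-1}]$-module, so the coefficients $r_w^{x,y}$ are well defined. *)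

(* Defs.v *)
From HB Require Import structures.
From mathcomp Require Import all_boot all_order all_algebra finmap.
From mathcomp Require Import boolp classical_sets.

Set Implicit Arguments.
Unset Strict Implicit.
Unset Printing Implicit Defensive.

Import GRing.Theory.
Local Open Scope ring_scope.

Local Notation "p %:F" := (tofrac p).

(* Z[v, v^-1] as the subring of Frac(Z[X]) of the fractions p / X^n,
   with v the image of X. *)
Definition laurent_pred : {pred {fraction {poly int}}} :=
  fun f => `[< exists (p : {poly int}) (n : nat),
                 f = p%:F / (('X : {poly int})%:F) ^+ n >].

Lemma laurent_subring_closed : subring_closed laurent_pred.
Proof.
have X0 : (('X : {poly int})%:F) != 0 by rewrite tofrac_eq0 polyX_eq0.
have Xn0 n : (('X : {poly int})%:F) ^+ n != 0 by rewrite expf_neq0.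
split.
- by apply/asboolP; exists 1, 0%N; rewrite expr0 divr1 tofrac1.
- move=> f g /asboolP[p [n ->]] /asboolP[q [m ->]]; apply/asboolP.
  exists (p * 'X^m - q * 'X^n), (n + m)%N.
  rewrite tofracB !tofracM !tofracXn exprD mulrBl; congr (_ - _).
    by rewrite -mulf_div divff // mulr1.
  by rewrite [X in _ = _ / X]mulrC -mulf_div divff // mulr1.
- move=> f g /asboolP[p [n ->]] /asboolP[q [m ->]]; apply/asboolP.
  by exists (p * q), (n + m)%N; rewrite mulf_div tofracM exprD.
Qed.

HB.instance Definition _ :=
  GRing.isSubringClosed.Build _ laurent_pred laurent_subring_closed.

Record laurent : predArgType := Laurent {
  laurent_val :> {fraction {poly int}};
  laurent_valP : laurent_val \in laurent_pred }.

HB.instance Definition _ := [isSub for laurent_val].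
HB.instance Definition _ := [Choice of laurent by <:].
HB.instance Definition _ := [SubChoice_isSubComNzRing of laurent by <:].

Lemma vpow_subproof (z : int) : ('X : {poly int})%:F ^ z \in laurent_pred.
Proof.
apply/asboolP; case: z => n.
  by exists 'X^n, 0%N; rewrite expr0 divr1 tofracXn.
by exists 1, n.+1; rewrite NegzE tofrac1 div1r -exprnN.
Qed.

(* v^z for z : int *)
Definition vpow (z : int) : laurent := Laurent (vpow_subproof z).

Section Coxeter.
Variables (W : groupType) (S : set W).

Definition is_order (G : groupType) (x : G) (n : nat) : Prop :=
  [/\ (0 < n)%N, (x ^+ n)%g = 1%g
    & forall m : nat, (0 < m < n)%N -> (x ^+ m)%g <> 1%g].

Definition expression (x : W) (u : seq W) : Prop :=
  (forall s, s \in u -> S s) /\ (\prod_(s <- u) s)%g = x.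

(* S consists of elements of order 2 and generates W (since the generators are
   involutions, words in S suffice), and W is presented by the relations
   (s t)^m = 1 for s, t in S such that s t has finite order m; the case s = t
   gives s^2 = 1. *)
Record coxeter_system : Prop := CoxeterSystem {
  coxeter_order2 : forall s, S s -> is_order s 2;
  coxeter_gen : forall x, exists u, expression x u;
  coxeter_pres : forall (G : groupType) (f : W -> G),
    (forall s t n, S s -> S t -> is_order (s * t)%g n ->
       ((f s * f t) ^+ n)%g = 1%g) ->
    exists phi : {multiplicative W -> G}, forall s, S s -> phi s = f s }.

Definition reduced_expression (x : W) (u : seq W) : Prop :=
  expression x u /\ forall u', expression x u' -> (size u <= size u')%N.

(* a chosen reduced expression; [::] only if S does not generate x *)
Definition redexpr (x : W) : seq W :=
  xget [::] [set u | reduced_expression x u].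

Definition cox_length (x : W) : nat := size (redexpr x).

Definition weight_function (L : W -> int) : Prop :=
  forall x y, cox_length (x * y)%g = (cox_length x + cox_length y)%N ->
    L (x * y)%g = L x + L y.

(* a b a ... with n factors *)
Definition altprod (R : nzRingType) (a b : R) (n : nat) : R :=
  \prod_(i < n) (if odd i then b else a).

(* Families indexed by S are represented by functions on W, of which only the
   values on S matter. *)
Definition hecke_relations (L : W -> int) (A : algType laurent) (T : W -> A) :
    Prop :=
  (forall s, S s ->
     (T s - (vpow (L s))%:A) * (T s + (vpow (- L s))%:A) = 0) /\
  (forall s t n, S s -> S t -> s <> t -> is_order (s * t)%g n ->
     altprod (T s) (T t) n = altprod (T t) (T s) n).

(* (H, T) is the Z[v, v^-1]-algebra presented by generators T_s (s in S) and
   the Hecke relations. *)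
Definition is_hecke_algebra (L : W -> int) (H : algType laurent) (T : W -> H) :
    Prop :=
  hecke_relations L T /\
  forall (A : algType laurent) (t : W -> A), hecke_relations L t ->
    exists phi : {lrmorphism H -> A},
      (forall s, S s -> phi (T s) = t s) /\
      (forall psi : {lrmorphism H -> A},
         (forall s, S s -> psi (T s) = t s) -> psi =1 phi).

(* T_x, through the chosen reduced expression of x; by Matsumoto's theorem the
   choice is irrelevant when the braid relations hold. *)
Definition heckeT (H : algType laurent) (T : W -> H) (x : W) : H :=
  \prod_(s <- redexpr x) T s.

End Coxeter.

(* Main.v *)
Require Import Defs.
From HB Require Import structures.
From mathcomp Require Import all_boot all_order all_algebra finmap.
From mathcomp Require Import boolp classical_sets functions.

Set Implicit Arguments.
Unset Strict Implicit.
Unset Printing Implicit Defensive.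

Import GRing.Theory.
Local Open Scope ring_scope.

(** Comparing coefficients in the T_w needs their linear independence in an
    algebra that is only given by a presentation.  It comes from a
    representation on the space V of all functions f : W -> Z[v, v^-1], thought
    of as the linear forms on the Hecke algebra through f (T_w) := f w:
    T_s acts by the formula that (T_s f) (T_w) = f (T_w T_s) would give, namely
    f (w s) when ws > w and f (w s) + (v_s - v_s^-1) f w when ws < w
    ([rmul]).  The quadratic relation is a direct computation
    ([rmul_quadratic]).  For the braid relations one introduces the mirror
    operators f |-> f (T_s _) ([lmul]), which commute with the first ones
    ([rmul_lmul]); an operator that commutes with all of them is determined by
    the values at 1 of the functions that it produces ([endo_eq_at1]), and for
    the two sides of a braid relation these values are f at the two alternating
    expressions of one element of W ([rmul_braid]).

    In this representation (T_x f) 1 = f x ([rmul_prod_ascending]).  Letting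
    both sides of the expansion of T_x T_y act on the indicator function d of w
    and evaluating at 1 gives r_w = (T_y d) x.  The bounds on l(w) then follow
    by induction along a reduced expression of y = s y' ([rmul_prod_support]):
    the terms that occur are T_{xs} T_{y'} and, when xs < x, also T_x T_{y'}.
    Only the lower bound for the second one is not immediate; with z = xs it is
    the inequality l(z y') <= l(z s y') for zs > z and s y' > y'
    ([leq_length_insert]).

    The combinatorics of (W, S) rests on one cocycle: n w t is the parity of
    the number of occurrences of the reflection t among the right inversions of
    a word for w.  It is obtained from the presentation of W by mapping W to a
    semidirect product of the group of functions W -> bool with W
    ([inversion_cocycle_exists]), and for a reflection t it decides whether
    wt is shorter than w ([inversionE]). *)

(** * Endomorphisms of the space of functions on a group *)

Section Endomorphisms.
Variables (R : comNzRingType) (X : groupType).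

Local Notation V := (X -> R^o).

Definition linear_pred : {pred V -> V} := fun f => `[< linear f >].

Lemma linear_pred_submod : submod_closed linear_pred.
Proof.
split.
  by apply/asboolP=> a u v; rewrite scaler0 addr0.
move=> a f g /asboolP lf /asboolP lg; apply/asboolP=> b u v.
rewrite !addrfctE !scalrfctE /= lf lg; apply/funext=> x.
rewrite !addrfctE !scalrfctE.
by rewrite !scalerDr !scalerA [a * b]mulrC addrACA.
Qed.

HB.instance Definition _ :=
  GRing.isSubmodClosed.Build R (V -> V) linear_pred linear_pred_submod.

Record endo : predArgType := Endo {
  endo_fun :> V -> V;
  endo_linear : endo_fun \in linear_pred }.

HB.instance Definition _ := [isSub for endo_fun].
HB.instance Definition _ := [Choice of endo by <:].
HB.instance Definition _ := [SubChoice_isSubLmodule of endo by <:].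

Lemma endoP (f g : endo) : (forall u x, f u x = g u x) -> f = g.
Proof. by move=> fg; apply/val_inj/funext=> u; apply/funext=> x. Qed.

Lemma endo_lin (f : endo) : linear f.
Proof. exact/asboolP/(endo_linear f). Qed.

Lemma endo1_subproof : (id : V -> V) \in linear_pred.
Proof. exact/asboolP. Qed.

Lemma endoM_subproof (f g : endo) : (f : V -> V) \o g \in linear_pred.
Proof. by apply/asboolP=> a u v /=; rewrite !endo_lin. Qed.

Definition endo1 : endo := Endo endo1_subproof.
Definition endoM (f g : endo) : endo := Endo (endoM_subproof f g).

Lemma endoDE (f g : endo) u x : (f + g) u x = f u x + g u x.
Proof. by []. Qed.

Lemma endoZE a (f : endo) u x : (a *: f) u x = a * f u x.
Proof. by []. Qed.

Fact endoMA : associative endoM.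
Proof. by move=> f g h; apply: endoP. Qed.
Fact endo1M : left_id endo1 endoM.
Proof. by move=> f; apply: endoP. Qed.
Fact endoM1 : right_id endo1 endoM.
Proof. by move=> f; apply: endoP. Qed.
Fact endoMDl : left_distributive endoM +%R.
Proof. by move=> f g h; apply: endoP. Qed.
Fact endoMDr : right_distributive endoM +%R.
Proof.
move=> f g h; apply: endoP => u x.
have := endo_lin f 1 (g u) (h u); rewrite !scale1r.
by move/(congr1 (fun k => k x)).
Qed.
(** The identity element of X is a point at which the constant function 1 does
    not vanish. *)
Fact endo1_neq0 : endo1 != 0.
Proof.
apply/eqP=> /(congr1 (fun f : endo => f (fun=> 1) 1%g)) /eqP.
by rewrite oner_eq0.
Qed.

HB.instance Definition _ := GRing.Zmodule_isNzRing.Build endo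
  endoMA endo1M endoM1 endoMDl endoMDr endo1_neq0.

Fact endo_scaleAl a (f g : endo) : a *: (f * g) = (a *: f) * g.
Proof. by apply: endoP. Qed.

HB.instance Definition _ := GRing.Lmodule_isLalgebra.Build R endo endo_scaleAl.

Fact endo_scaleAr a (f g : endo) : a *: (f * g) = f * (a *: g).
Proof.
apply: endoP => u x; have := endo_lin f a (g u) 0; rewrite !addr0.
have -> : f 0 = 0 by have := endo_lin f (-1) 0 0; rewrite scaler0 addr0 scaleN1r addNr.
by rewrite addr0 => /(congr1 (fun k => k x)) /esym.
Qed.
HB.instance Definition _ := GRing.Lalgebra_isAlgebra.Build R endo endo_scaleAr.

Lemma endoME (f g : endo) u : (f * g) u = f (g u).
Proof. by []. Qed.

Lemma endo1E u : (1 : endo) u = u.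
Proof. by []. Qed.
End Endomorphisms.

(** * The inversion cocycle *)

Section ReflectionExtension.
Variable W : groupType.

(** The semidirect product of the functions W -> bool, added pointwise modulo 2,
    with W acting on them by conjugating the argument. *)
Record refl_ext := ReflExt { ext_par : W -> bool; ext_base : W }.

HB.instance Definition _ := gen_eqMixin refl_ext.
HB.instance Definition _ := gen_choiceMixin refl_ext.

Lemma refl_extP (a b : refl_ext) :
  ext_par a =1 ext_par b -> ext_base a = ext_base b -> a = b.
Proof. by case: a b => [p g] [p' g'] /= /funext -> ->. Qed.

Definition ext_one := ReflExt (fun=> false) 1%g.
Definition ext_mul a b := ReflExt
  (fun t => ext_par b t (+) ext_par a (t ^ (ext_base b)^-1)%g)
  (ext_base a * ext_base b)%g.
Definition ext_inv a :=
  ReflExt (fun t => ext_par a (t ^ ext_base a)%g) (ext_base a)^-1%g.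

Fact ext_mulA : associative ext_mul.
Proof.
move=> a b c; apply: refl_extP => [t|] /=; last exact: mulgA.
by rewrite invgM conjgM addbA.
Qed.
Fact ext_mul1 : left_id ext_one ext_mul.
Proof. by move=> a; apply: refl_extP => [t|] /=; rewrite ?addbF ?mul1g. Qed.
Fact ext_1mul : right_id ext_one ext_mul.
Proof. by move=> a; apply: refl_extP => [t|] /=; rewrite ?invg1 ?conjg1 ?mulg1. Qed.
Fact ext_mulV : left_inverse ext_one ext_inv ext_mul.
Proof.
by move=> a; apply: refl_extP => [t|] /=; rewrite ?conjgKV ?addbb ?mulVg.
Qed.
Fact ext_Vmul : right_inverse ext_one ext_inv ext_mul.
Proof.
by move=> a; apply: refl_extP => [t|] /=; rewrite ?invgK ?addbb ?mulgV.
Qed.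

HB.instance Definition _ := isGroup.Build refl_ext
  ext_mulA ext_mul1 ext_1mul ext_mulV ext_Vmul.

Definition ext_gen (s : W) : refl_ext := ReflExt (fun t => t == s) s.

Lemma ext_parM (a b : refl_ext) t :
  ext_par (a * b)%g t = ext_par b t (+) ext_par a (t ^ (ext_base b)^-1)%g.
Proof. by []. Qed.

Lemma ext_baseM (a b : refl_ext) :
  ext_base (a * b)%g = (ext_base a * ext_base b)%g.
Proof. by []. Qed.

Lemma ext_baseX (a : refl_ext) k : ext_base (a ^+ k)%g = (ext_base a ^+ k)%g.
Proof. by elim: k => [|k IHk] //; rewrite !expgS ext_baseM IHk. Qed.

(** Conjugation by t inverts r = s t, so r^-k t = t r^k. *)
Lemma dihedral_conj (s t : W) k : (s * s = 1)%g -> (t * t = 1)%g ->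
  (t ^ ((s * t) ^+ k) = t * (s * t) ^+ k.*2)%g.
Proof.
move=> s2 t2; set r := (s * t)%g.
have rt : (r * t * r = t)%g by rewrite /r -!mulgA (mulgA t t) t2 mul1g mulgA s2 mul1g.
have rkt : (r ^+ k * t * r ^+ k = t)%g.
  elim: k => [|k IHk]; first by rewrite mul1g mulg1.
  by rewrite {1}expgS expgSr -[RHS]rt -[in RHS]IHk !mulgA.
by rewrite -addnn expgnDr /conjg -{1}rkt !mulgA mulVg mul1g.
Qed.

(** The reflections met along the word (s t)^k are t (s t)^i for i < 2k, so
    they repeat with period the order of s t; hence when (s t)^k = 1 each one
    is met an even number of times. *)
Lemma ext_par_genX (s t : W) k u : (s * s = 1)%g -> (t * t = 1)%g ->
  ext_par ((ext_gen s * ext_gen t) ^+ k)%g u =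
  odd (\sum_(i < k.*2) (u == t * (s * t) ^+ i)%g).
Proof.
move=> s2 t2; elim: k => [|k IHk]; first by rewrite big_ord0.
have conjE (v x a : W) : ((v ^ x^-1)%g == a) = (v == a ^ x)%g.
  by apply/eqP/eqP=> [<-|->]; rewrite ?conjgKV ?conjgK.
rewrite expgS ext_parM IHk ext_baseX doubleS !big_ord_recr /= !oddD !oddb.
rewrite -addbA; congr (_ (+) _); rewrite !conjE dihedral_conj //.
congr (_ (+) (_ == _)).
rewrite -conjgM conjgM (_ : s ^ t = t * (s * t) ^+ 1)%g; last first.
  by rewrite expg1 /conjg (mulg1_eq t2).
rewrite conjMg dihedral_conj // -mulgA; congr (t * _)%g.
by rewrite expg1 /conjg -expgS {1}expgSr mulKg -expgSr.
Qed.

Lemma ext_gen_rel (s t : W) k : (s * s = 1)%g -> (t * t = 1)%g ->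
  ((s * t) ^+ k = 1)%g -> ((ext_gen s * ext_gen t) ^+ k = 1)%g.
Proof.
move=> s2 t2 rk; apply: refl_extP => [u|]; last first.
  by rewrite ext_baseX ext_baseM.
rewrite ext_par_genX // -addnn big_split_ord /=.
under [X in (_ + X)%N]eq_bigr => i _ do rewrite expgnDr rk mul1g.
by rewrite addnn odd_double.
Qed.
End ReflectionExtension.

(** Existence is where the presentation of W is used: a map prescribed on S
    extends to W only if the Coxeter relations hold, which is [ext_gen_rel]. *)
Lemma inversion_cocycle_exists (W : groupType) (S : set W) :
  coxeter_system S -> exists n : W -> W -> bool,
    (forall g h t, n (g * h)%g t = n h t (+) n g (t ^ h^-1)%g) /\
    (forall s t, S s -> n s t = (t == s)).
Proof.
case=> ord2 gen pres.
have sq s : S s -> (s * s = 1)%g by move=> /ord2[_ + _]; rewrite expgS expg1.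
have [|phi phiE] := pres (refl_ext W) (@ext_gen W).
  by move=> s t k Ss St [_ rk _]; apply: ext_gen_rel rk; apply: sq.
have phi_base w : ext_base (phi w) = w.
  have [u [Su <-]] := gen w; elim: u Su => [|s u IHu] Su.
    rewrite big_nil; apply: (mulgI (ext_base (phi 1%g))).
    by rewrite mulg1 -ext_baseM -gmulfM mulg1.
  rewrite big_cons gmulfM ext_baseM IHu => [|v vu]; last by apply: Su; rewrite inE vu orbT.
  by rewrite phiE //; apply: Su; rewrite mem_head.
exists (fun w => ext_par (phi w)); split=> [g h t|s t Ss].
  by rewrite gmulfM ext_parM phi_base.
by rewrite phiE.
Qed.

(** * Length and inversions *)

Lemma conjg_selfV (W : groupType) (t : W) : (t ^ t^-1 = t)%g.
Proof. by rewrite /conjg invgK mulgV mulg1. Qed.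

Section Length.
Variables (W : groupType) (S : set W).
Hypothesis hWS : coxeter_system S.
Variable n : W -> W -> bool.
Hypothesis nM : forall g h t, n (g * h)%g t = n h t (+) n g (t ^ h^-1)%g.
Hypothesis nS : forall s t, S s -> n s t = (t == s).

Local Notation l := (cox_length S).

Lemma gen_sq s : S s -> (s * s = 1)%g.
Proof. by move=> /(coxeter_order2 hWS)[_ + _]; rewrite expgS expg1. Qed.

(** The chosen word is really reduced: words for x exist since S generates W,
    so a shortest one does. *)
Lemma redexprP x : reduced_expression S x (redexpr S x).
Proof.
suff: exists u, reduced_expression S x u by move/(xgetPex [::]).
apply: contrapT => /forallNP nored; have [u xu] := coxeter_gen hWS x.
have [m] := ubnP (size u); elim: m => // m IHm in u xu *; rewrite ltnS => um.
apply: (nored u); split=> // u' xu'; rewrite leqNgt; apply/negP=> lt_u'u.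
exact: IHm xu' (leq_trans lt_u'u um).
Qed.

Lemma cox_length_le x u : expression S x u -> (l x <= size u)%N.
Proof. by case: (redexprP x) => _; apply. Qed.

Lemma expression_cons s u x : expression S x (s :: u) ->
  S s /\ expression S (s^-1 * x)%g u.
Proof.
case=> Su <-; rewrite big_cons mulKg; split; first by apply: Su; rewrite mem_head.
by split=> // v vu; apply: Su; rewrite inE vu orbT.
Qed.

Lemma cons_expression s u x : S s -> expression S x u ->
  expression S (s * x)%g (s :: u).
Proof.
move=> Ss [Su <-]; split; last by rewrite big_cons.
by move=> v; rewrite inE => /predU1P[->|/Su].
Qed.

Lemma inversion1 t : n 1%g t = false.
Proof. by have := nM 1 1 t; rewrite mulg1 invg1 conjg1 addbb. Qed.

(** An odd number of occurrences is a nonzero number: if t is the inversion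
    contributed by the letter s, then multiplying by t deletes that letter. *)
Lemma strong_exchange x t u : expression S x u -> n x t ->
  exists2 u', expression S (x * t)%g u' & (size u' < size u)%N.
Proof.
elim: u x => [|s u IHu] x.
  by case=> _ <-; rewrite big_nil inversion1.
move=> /[dup] /expression_cons[Ss xu] _; set y := (s^-1 * x)%g in xu.
have -> : x = (s * y)%g by rewrite mulVKg.
rewrite nM (nS _ Ss); case nyt: (n y t); [move=> _|move=> /= /eqP tE].
  have [u' yu' lt_u'] := IHu _ xu nyt; exists (s :: u') => //.
  by rewrite -mulgA; apply: cons_expression.
exists u; last by [].
have -> : t = (s ^ y)%g by rewrite -tE conjgKV.
by rewrite /conjg -mulgA mulVKg mulgA gen_sq // mul1g.
Qed.

Lemma ltn_length_inversion x t : n x t -> (l (x * t)%g < l x)%N.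
Proof.
have [xred _] := redexprP x; case/(strong_exchange xred) => u' /cox_length_le.
exact: leq_ltn_trans.
Qed.

Lemma inversionV g t : n g^-1%g t = n g (t ^ g)%g.
Proof.
have := nM g g^-1 t; rewrite mulgV inversion1 invgK.
by case: (n _ _) (n _ _) => [] [].
Qed.

(** In the palindrome y^-1 s y the two outer halves contribute the same value,
    so only the central letter counts. *)
Lemma inversion_refl s y : S s -> n (s ^ y)%g (s ^ y)%g.
Proof.
move=> Ss; rewrite {1}/conjg nM nM invgM conjgM conjgK (nS _ Ss) eqxx.
by rewrite conjg_selfV inversionV addbT addNb addbb.
Qed.

(** If t is not an inversion of x then it is one of xt, by [inversion_refl]. *)
Lemma gtn_length_noninversion x s y : S s -> ~~ n x (s ^ y)%g ->
  (l x < l (x * s ^ y)%g)%N.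
Proof.
move=> Ss nxt; have := @ltn_length_inversion (x * s ^ y)%g (s ^ y)%g.
have t2 : (s ^ y * s ^ y = 1)%g by rewrite -conjMg gen_sq // conj1g.
rewrite nM inversion_refl // -mulgA t2 mulg1.
by rewrite conjg_selfV; move=> /= ->.
Qed.

Lemma inversionE x s y : S s ->
  n x (s ^ y)%g = (l (x * s ^ y)%g < l x)%N.
Proof.
move=> Ss; apply/idP/idP; first exact: ltn_length_inversion.
by apply: contraTT => /(gtn_length_noninversion Ss); rewrite -leqNgt; apply: ltnW.
Qed.

Lemma cox_lengthMr w s : S s ->
  l (w * s)%g = if n w s then (l w).-1 else (l w).+1.
Proof.
move=> Ss; have le1 x : (l (x * s)%g <= (l x).+1)%N.
  have [[Su xE] _] := redexprP x; rewrite -(size_rcons _ s).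
  apply: cox_length_le; split=> [v|].
    by rewrite mem_rcons inE => /predU1P[->|/Su].
  by rewrite -cats1 big_cat big_seq1 /= xE.
have := le1 w; have := le1 (w * s)%g.
rewrite -mulgA gen_sq // mulg1; case: ifP => nws.
  have := ltn_length_inversion nws; case: (l w) => // k.
  by rewrite !ltnS => kl lk _; apply/eqP; rewrite eqn_leq kl lk.
have := @gtn_length_noninversion w s 1 Ss; rewrite conjg1 nws => /(_ isT).
by move=> lt _ le; apply/eqP; rewrite eqn_leq le lt.
Qed.

Lemma cox_length1 : l 1%g = 0%N.
Proof.
apply/eqP; rewrite -leqn0; apply: (@cox_length_le 1%g [::]).
by split; rewrite ?big_nil.
Qed.

Lemma cox_length_gen s : S s -> l s = 1%N.
Proof. by move=> Ss; rewrite -[s]mul1g cox_lengthMr // inversion1 cox_length1. Qed.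

Lemma left_descentE s w : S s -> n w (s ^ w)%g = (l (s * w)%g < l w)%N.
Proof. by move=> Ss; rewrite inversionE // /conjg mulVKg. Qed.

(** z s y is z y times the reflection s^y, and the cocycle at s^y splits into
    the contributions of z and of y: inserting s at a place where it lengthens
    both neighbours lengthens the product, even if z y itself is not a reduced
    product. *)
Lemma leq_length_insert z s y : S s ->
  ~~ n z s -> ~~ n y (s ^ y)%g -> (l (z * y)%g <= l (z * s * y)%g)%N.
Proof.
move=> Ss nzs nsy; have := @gtn_length_noninversion (z * y)%g s y Ss.
rewrite nM conjgK (negPf nzs) addbF => /(_ nsy) /ltnW.
by rewrite /conjg !mulgA mulgK.
Qed.

(** L(tw) = L(ws) can be expanded on both sides as soon as ws > w; otherwise
    ws satisfies the same equation and is shorter. *)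
Lemma conjugate_weight (L : W -> int) s t w : weight_function S L ->
  S s -> S t -> (t * w = w * s)%g -> L s = L t.
Proof.
move=> hL Ss St; wlog nws : w / ~~ n w s.
  move=> wlog_up tw; case nws: (n w s); last by apply: wlog_up tw; rewrite nws.
  apply: (wlog_up (w * s)%g); last by rewrite mulgA tw.
  by rewrite nM (nS _ Ss) conjg_selfV nws eqxx.
move=> tw; apply: (@addrI _ (L w)).
have lws : l (w * s)%g = (l w).+1 by rewrite cox_lengthMr // (negPf nws).
have <- : L (w * s)%g = L w + L s by apply: hL; rewrite lws (cox_length_gen Ss) addn1.
by rewrite -tw [RHS]addrC; apply: hL; rewrite tw lws (cox_length_gen St) add1n.
Qed.
End Length.

(** * Alternating words *)

Section AlternatingWords.
Variable W : groupType.

Fixpoint altw (s t : W) (k : nat) : seq W :=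
  if k is k'.+1 then s :: altw t s k' else [::].

Definition altg s t k : W := (\prod_(x <- altw s t k) x)%g.

Definition altnext (s t : W) k := if odd k then t else s.

Lemma altgS s t k : altg s t k.+1 = (s * altg t s k)%g.
Proof. by rewrite /altg big_cons. Qed.

Lemma altwSr s t k : altw s t k.+1 = rcons (altw s t k) (altnext s t k).
Proof.
elim: k s t => [|k IHk] s t //.
by rewrite -[LHS]/(s :: altw t s k.+1) IHk /= /altnext /=; case: odd.
Qed.

Lemma altgSr s t k : altg s t k.+1 = (altg s t k * altnext s t k)%g.
Proof. by rewrite /altg altwSr -cats1 big_cat big_seq1. Qed.

Lemma altg_divg s t k : (s * s = 1)%g -> (t * t = 1)%g ->
  (altg s t k / altg t s k = (s * t) ^+ k)%g.
Proof.
move=> s2 t2; elim: k s t s2 t2 => [|k IHk] s t s2 t2.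
  by rewrite /altg !big_nil divg1.
rewrite !altgS invgM (mulg1_eq t2) !mulgA -(mulgA s).
rewrite [(altg t s k / _)%g]IHk //.
have E m : (s * (t * s) ^+ m * t = (s * t) ^+ m.+1)%g.
  elim: m => [|m IHm]; first by rewrite mulg1 expg1.
  by rewrite [in RHS]expgSr -IHm expgSr !mulgA.
exact: E.
Qed.

Lemma altprodE (A : nzRingType) (f : W -> A) s t k :
  altprod (f s) (f t) k = \prod_(x <- altw s t k) f x.
Proof.
rewrite /altprod; elim: k s t => [|k IHk] s t.
  by rewrite big_ord0 big_nil.
rewrite big_ord_recl /= big_cons -IHk; congr (_ * _).
by apply: eq_bigr => i _; rewrite /= add0n; case: odd.
Qed.

End AlternatingWords.

(** * The right regular representation on functions *)

Section RegularRepresentation.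
Variables (W : groupType) (S : set W).
Hypothesis hWS : coxeter_system S.
Variable n : W -> W -> bool.
Hypothesis nM : forall g h t, n (g * h)%g t = n h t (+) n g (t ^ h^-1)%g.
Hypothesis nS : forall s t, S s -> n s t = (t == s).
Local Notation l := (cox_length S).

Variables (R : comNzRingType) (q : W -> R).
(* The condition under which right and left multiplication operators commute. *)
Hypothesis qJ : forall s t w, S s -> S t -> (t * w = w * s)%g -> q s = q t.

Local Notation V := (W -> R^o).

(** f |-> f (T_w T_s), for f extended linearly to the Hecke algebra; q s
    stands for v_s - v_s^-1. *)
Definition rmul_fun (s : W) (f : V) : V :=
  fun w => f (w * s)%g + (if n w s then q s * f w else 0).

(** f |-> f (T_s T_w); by [left_descentE] the reflection s^w is an inversion
    of w exactly when sw < w. *)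
Definition lmul_fun (s : W) (f : V) : V :=
  fun w => f (s * w)%g + (if n w (s ^ w)%g then q s * f w else 0).

Lemma rmul_linear s : rmul_fun s \in @linear_pred R W.
Proof.
apply/asboolP=> a u v; apply/funext=> w.
rewrite /rmul_fun !addrfctE !scalrfctE; case: ifP => _; last by rewrite !addr0.
rewrite mulrDr !scalerDr addrACA; congr (_ + _).
by congr (_ + _); exact: mulrCA.
Qed.

Lemma lmul_linear s : lmul_fun s \in @linear_pred R W.
Proof.
apply/asboolP=> a u v; apply/funext=> w.
rewrite /lmul_fun !addrfctE !scalrfctE; case: ifP => _; last by rewrite !addr0.
rewrite mulrDr !scalerDr addrACA; congr (_ + _).
by congr (_ + _); exact: mulrCA.
Qed.

Definition rmul s : endo R W := Endo (rmul_linear s).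
Definition lmul s : endo R W := Endo (lmul_linear s).

Lemma rmulE s (f : V) w :
  rmul s f w = f (w * s)%g + (if n w s then q s * f w else 0).
Proof. by []. Qed.

Lemma lmulE s (f : V) w :
  lmul s f w = f (s * w)%g + (if n w (s ^ w)%g then q s * f w else 0).
Proof. by []. Qed.

Lemma rmul_sqr s : S s -> rmul s * rmul s = q s *: rmul s + 1.
Proof.
move=> Ss; apply: endoP => f w; rewrite endoME endoDE endoZE endo1E !rmulE.
rewrite nM (nS _ Ss) conjg_selfV eqxx -mulgA (gen_sq hWS Ss) mulg1.
case: (n w s) => /=; first by rewrite addr0 [RHS]addrC.
by rewrite !addr0 addrC.
Qed.

Lemma rmul_quadratic s a b : S s -> a * b = 1 -> q s = a - b ->
  (rmul s - a%:A) * (rmul s + b%:A) = 0.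
Proof.
move=> Ss ab qE; rewrite mulrBl !mulrDr rmul_sqr // !mulr_algl mulr_algr.
by rewrite scalerA ab scale1r qE scalerBl [X in X - _]addrAC subrK subrr.
Qed.

(** Multiplying by s on the right changes the inversion status of t^w, and
    multiplying by t on the left that of s, only if tw = ws; in that case the
    two operators agree term by term since q s = q t. *)
Lemma rmul_lmul s t : S s -> S t -> rmul s * lmul t = lmul t * rmul s.
Proof.
move=> Ss St; apply: endoP => f w; rewrite !endoME !(rmulE, lmulE).
have nws : n (w * s)%g (t ^ (w * s))%g = (t ^ w == s)%g (+) n w (t ^ w)%g.
  rewrite nM conjgM conjgK (nS _ Ss); congr (_ (+) _).
  by apply/eqP/eqP=> [/(congr1 (fun x => x ^ s^-1)%g)|->];
    rewrite ?conjgK ?conjg_selfV // /conjg mulKg.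
have ntw : n (t * w)%g s = n w s (+) (t ^ w == s)%g.
  rewrite nM (nS _ St); congr (_ (+) _).
  by apply/eqP/eqP=> <-; rewrite ?conjgK ?conjgKV.
rewrite nws ntw !mulgA; case: eqP => [tws|_] /=.
  have tw : (t * w = w * s)%g by rewrite -tws /conjg mulVKg.
  rewrite tws tw (qJ Ss St tw); case: (n w s) => /=; last by rewrite !addr0.
  by rewrite !addr0.
rewrite addbF; case: (n w s); case: (n w _); rewrite ?addr0 //.
rewrite !mulrDr -!addrA; congr (_ + _); rewrite addrCA; congr (_ + (_ + _)).
exact: mulrCA.
Qed.

(** The value of f at w = s y is recovered from the values of f and lmul s f
    at y, so the values at 1 of all images under an operator commuting with the
    lmul s determine it. *)
Lemma endo_eq_at1 (A B : endo R W) :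
    (forall t, S t -> A * lmul t = lmul t * A) ->
    (forall t, S t -> B * lmul t = lmul t * B) ->
  (forall f : V, A f 1%g = B f 1%g) -> A = B.
Proof.
move=> cA cB AB1; apply: endoP => f w; have [u [Su <-]] := coxeter_gen hWS w.
elim: u Su f => [|s u IHu] Su f; first by rewrite big_nil.
rewrite big_cons; set y := (\prod_(x <- u) x)%g in IHu *.
have Ss : S s by apply: Su; rewrite mem_head.
have {}IHu g : A g y = B g y by apply: IHu => v vu; apply: Su; rewrite inE vu orbT.
have := IHu (lmul s f); rewrite -!endoME cA // cB // !endoME !lmulE IHu.
exact: addIr.
Qed.

(** Each letter of u lengthens the product of x and the letters before it.
    Letter by letter, this is what makes the second term of rmul vanish, and
    for alternating words it can be checked with the cocycle alone. *)
Fixpoint ascending (x : W) (u : seq W) : bool :=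
  if u is s :: u' then ~~ n x s && ascending (x * s)%g u' else true.

Lemma ascending_rcons x u t :
  ascending x (rcons u t) =
  ascending x u && ~~ n (x * \prod_(s <- u) s)%g t.
Proof.
elim: u x => [|s u IHu] x /=; first by rewrite big_nil mulg1 andbT.
by rewrite IHu big_cons mulgA andbA.
Qed.

Lemma rmul_prod_ascending (f : V) x u : ascending x u ->
  (\prod_(s <- u) rmul s) f x = f (x * \prod_(s <- u) s)%g.
Proof.
elim: u x => [|s u IHu] x /=; first by rewrite !big_nil mulg1.
case/andP=> nxs asc; rewrite !big_cons endoME rmulE (negPf nxs) addr0 IHu //.
by rewrite mulgA.
Qed.

Lemma reduced_ascending x u : (forall s, s \in u -> S s) ->
  l (x * \prod_(s <- u) s)%g = (l x + size u)%N -> ascending x u.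
Proof.
elim: u x => [|s u IHu] x //= Su; rewrite big_cons mulgA => lE.
have Ss : S s by apply: Su; rewrite mem_head.
have {}Su v : v \in u -> S v by move=> vu; apply: Su; rewrite inE vu orbT.
have leM y : (l (y * \prod_(x <- u) x)%g <= l y + size u)%N.
  have [[Sy yE] _] := redexprP hWS y; rewrite -size_cat; apply: cox_length_le => //.
  split=> [v|]; first by rewrite mem_cat => /orP[/Sy|/Su].
  by rewrite big_cat /= yE.
have := leM (x * s)%g; rewrite lE addnS -addSn leq_add2r.
have := cox_lengthMr hWS nM nS x Ss; case: (n x s) => lxs.
  by rewrite lxs ltnNge leq_pred.
by move=> _; rewrite IHu // lE lxs addnS addSn.
Qed.

(** If the next letter of an alternating word were a descent, then, the later
    letters being covered by the induction, its inversion would come from the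
    first letter, which says that the two alternating words of some length
    j < k coincide. *)
Lemma altw_ascending s t k : S s -> S t ->
    (forall j, (0 < j < k)%N -> altg s t j <> altg t s j) ->
  ascending 1%g (altw s t k).
Proof.
move=> Ss St; elim: k => [|k IHk] // neq.
rewrite altwSr ascending_rcons mul1g IHk /= => [|j /andP[j0 jk]]; last first.
  by apply: neq; rewrite j0 ltnW.
rewrite -/(altg s t k) /=; move: neq {IHk}.
elim: k s t Ss St => [|k IHk] s t Ss St neq.
  by rewrite /altg big_nil (inversion1 nM).
rewrite altgS nM (nS _ Ss).
have -> : altnext s t k.+1 = altnext t s k by rewrite /altnext /=; case: odd.
have /negPf-> : ~~ n (altg t s k) (altnext t s k).
  by apply: IHk => // j /andP[j0 jk] /esym; apply: neq; rewrite j0 ltnW.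
apply/eqP=> E; apply: (neq k.+1); rewrite ?ltnSn // altgS altgSr.
by rewrite [RHS]conjgCV E.
Qed.

(** By [endo_eq_at1] only the values at 1 matter; minimality of the order k
    makes both alternating words ascending, and (s t)^k = 1 makes them express
    the same element. *)
Lemma rmul_braid s t k : S s -> S t -> is_order (s * t)%g k ->
  altprod (rmul s) (rmul t) k = altprod (rmul t) (rmul s) k.
Proof.
move=> Ss St [_ rk minr].
have s2 := gen_sq hWS Ss; have t2 := gen_sq hWS St.
have neq j : (0 < j < k)%N -> altg s t j <> altg t s j.
  by move=> jk E; apply: (minr j jk); rewrite -altg_divg // E divgg.
have comm u v x : S x -> (forall y, y \in altw u v k -> S y) ->
    \prod_(y <- altw u v k) rmul y * lmul x =
    lmul x * \prod_(y <- altw u v k) rmul y.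
  move=> Sx; elim: (altw u v k) => [|y w IHw] Sw.
    by rewrite big_nil mul1r mulr1.
  rewrite big_cons -mulrA IHw => [|z zw]; last by apply: Sw; rewrite inE zw orbT.
  by rewrite !mulrA rmul_lmul //; apply: Sw; rewrite mem_head.
have Salt u v : S u -> S v -> forall y, y \in altw u v k -> S y.
  elim: k u v {rk minr neq comm} => [|j IHj] u v Su Sv y //=.
  by rewrite inE => /predU1P[->|/IHj]; last apply.
rewrite !altprodE; apply: endo_eq_at1 => [x Sx|x Sx|f].
- by apply: comm => //; apply: Salt.
- by apply: comm => //; apply: Salt.
rewrite !rmul_prod_ascending ?mul1g; first 1 last.
- by apply: altw_ascending => // j /neq ne /esym.
- exact: altw_ascending.
by congr f; apply: divg1_eq; rewrite [LHS]altg_divg.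
Qed.

(** Reading u = s u' from the left, the letter s moves the evaluation point
    from x to xs and, when xs < x, leaves a second term at x; for that term
    [leq_length_insert] gives the lower bound. *)
Lemma rmul_prod_support (f : V) x u : (forall s, s \in u -> S s) ->
    l (\prod_(s <- u) s)%g = size u ->
    (forall w, (l (x * \prod_(s <- u) s)%g <= l w <= l x + size u)%N ->
       f w = 0) ->
  (\prod_(s <- u) rmul s) f x = 0.
Proof.
elim: u x => [|s u IHu] x Su.
  rewrite !big_nil mulg1 /= addn0 => _ f0; apply: f0.
  by rewrite leqnn.
rewrite !big_cons; set y := (\prod_(x <- u) x)%g in IHu *.
rewrite [size _]/= => lsy f0.
have Ss : S s by apply: Su; rewrite mem_head.
have {}Su v : v \in u -> S v by move=> vu; apply: Su; rewrite inE vu orbT.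
have ly : l y = size u.
  apply/eqP; rewrite eqn_leq; apply/andP; split; first exact: cox_length_le.
  rewrite -ltnS -lsy.
  apply: (cox_length_le hWS (u := s :: redexpr S y)).
  by apply: cons_expression => //; case: (redexprP hWS y).
rewrite endoME rmulE; set F := \prod_(x <- u) rmul x in IHu *.
have lxs := cox_lengthMr hWS nM nS x Ss.
have -> : F f (x * s)%g = 0.
  apply: IHu => // w; rewrite -mulgA => /andP[lw wl]; apply: f0; rewrite lw /=.
  apply: leq_trans wl _; rewrite addnS -addSn leq_add2r lxs.
  by case: ifP => // _; apply: leq_trans (leq_pred _) _.
rewrite add0r; case: ifP => // nxs.
suff -> : F f x = 0 by rewrite mulr0.
apply: IHu => // w /andP[lw wl]; apply: f0; apply/andP; split; last first.
  by apply: leq_trans wl _; rewrite addnS.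
apply: leq_trans lw.
have := @leq_length_insert _ _ hWS _ nM nS (x * s)%g s y Ss.
rewrite -mulgA mulgA -[((x * s) * s)%g]mulgA (gen_sq hWS Ss) mulg1; apply.
  by rewrite nM (nS _ Ss) conjg_selfV nxs eqxx.
rewrite (left_descentE hWS nM nS) // lsy ly.
by rewrite -leqNgt.
Qed.

End RegularRepresentation.

(** * Coefficients of products of basis elements *)

Lemma endo_sumE (R : comNzRingType) (W : groupType) (I : Type) (r : seq I)
    (F : I -> endo R W) (u : W -> R^o) x :
  (\sum_(i <- r) F i) u x = \sum_(i <- r) F i u x.
Proof. exact: (big_morph (fun A : endo R W => A u x)). Qed.

Lemma vpowMN z : vpow z * vpow (- z) = 1.
Proof.
apply: val_inj; rewrite rmorphM rmorph1 /=.
by rewrite -expfzDr ?subrr // tofrac_eq0 polyX_eq0.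
Qed.

Theorem proposition1p2 (W : groupType) (S : set W)
    (hWS : coxeter_system S)
    (L : W -> int) (hL : weight_function S L)
    (H : algType laurent) (T : W -> H) (hH : is_hecke_algebra S L T)
    (x y : W) (r : {fsfun W -> laurent with 0})
    (hr : heckeT S T x * heckeT S T y
          = \sum_(w <- finsupp r) r w *: heckeT S T w)
    (w : W) :
  ~~ (cox_length S (x * y)%g <= cox_length S w
        <= cox_length S x + cox_length S y)%N ->
  r w = 0.
Proof.
have [n [nM nS]] := inversion_cocycle_exists hWS.
pose q s := vpow (L s) - vpow (- L s).
have qJ s t v : S s -> S t -> (t * v = v * s)%g -> q s = q t.
  by move=> Ss St tv; rewrite /q (conjugate_weight hWS nM nS hL Ss St tv).
have rel : hecke_relations S L (rmul n q).
  split=> [s Ss|s t k Ss St _]; last exact: (rmul_braid hWS nM nS qJ).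
  exact: (rmul_quadratic hWS nM nS Ss (vpowMN _)).
have [_ /(_ _ _ rel)[phi [phiT _]]] := hH.
have phiE z : phi (heckeT S T z) = \prod_(s <- redexpr S z) rmul n q s.
  have [[Sz _] _] := redexprP hWS z.
  by rewrite rmorph_prod; apply: eq_big_seq => s /Sz; apply: phiT.
have phi_at1 z f : phi (heckeT S T z) f 1%g = f z.
  have [[Sz zE] _] := redexprP hWS z; rewrite phiE.
  rewrite rmul_prod_ascending ?mul1g ?zE //.
  by apply: (reduced_ascending hWS nM nS) => //; rewrite mul1g zE cox_length1.
(* Applied to d and evaluated at 1, an expansion in the T_v returns the
   coefficient of T_w. *)
pose d : W -> laurent^o := fun v => (v == w)%:R.
have := congr1 (fun h => phi h d 1%g) hr.
rewrite rmorphM /= linear_sum endo_sumE phi_at1.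
under eq_bigr => v _ do rewrite linearZ endoZE phi_at1.
have -> : \sum_(v <- finsupp r) r v * d v = r w.
  have [wr|wr] := boolP (w \in finsupp r).
    rewrite (bigD1_seq w) ?fset_uniq //= big1 => [|v /negPf vw].
      by rewrite /d eqxx mulr1 addr0.
    by rewrite /d vw mulr0.
  rewrite fsfun_dflt // big1_seq // => v /andP[_ vr].
  by rewrite /d; case: eqP => [vw|_]; rewrite ?mulr0 //; rewrite -vw vr in wr.
move=> <- out; have [[Sy yE] _] := redexprP hWS y; rewrite phiE.
apply: (rmul_prod_support hWS nM nS) => //; rewrite yE // => v.
by rewrite /d; case: eqP => // ->; rewrite (negPf out).
Qed.
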